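(* Let $\alpha=(\alpha_1,\dots,\alpha_n)$ be a composition and let $m$ be an integer with $1\le m<|\alpha|$. Then the skew diagram $\delta_\alpha/(1^m)$ is a sum of fat staircases if and only if there is no $j$ with $1\le j\le n-1$ such that $\alpha_j\le m\le |\alpha|-\alpha_{j+1}$.
   Context: A composition $\alpha=(\alpha_1,\dots,\alpha_n)$ is a finite sequence of positive integers; $|\alpha|=\sum_{i=1}^n\alpha_i$. $\delta_\alpha=(n^{\alpha_n},(n-1)^{\alpha_{n-1}},\dots,1^{\alpha_1})$ is the partition with exactly $\alpha_i$ parts equal to $i$ for each $i=1,\dots,n$. A partition $\nu$ is a fat staircase if $\nu=\delta_\beta$ for some composition $\beta$. A skew diagram $D=\rho/\kappa$ is called a sum of fat staircases if in the Schur expansion $s_D=\sum_\nu c_{\kappa\nu}^{\rho}s_\nu$ of its skew Schur function ($c_{\kappa\nu}^\rho$ the Littlewood-Richardson coefficients) we have $c_{\kappa\nu}^{\rho}=0$ for every partition $\nu$ that is not a fat staircase. $(1^m)$ is the one-column partition with $m$ boxes. *)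

(* Defs.v *)
From mathcomp Require Import all_boot all_order all_algebra.
From mathcomp Require Import mpoly.

Set Implicit Arguments.
Unset Strict Implicit.
Unset Printing Implicit Defensive.

Import GRing.Theory.
Local Open Scope ring_scope.

Definition is_composition (alpha : seq nat) : bool := 0%N \notin alpha.

(* Parts of a composition are numbered from 1. *)
Definition cpart (alpha : seq nat) (i : nat) : nat := nth 0%N alpha i.-1.

(* Partitions have no trailing zeros, so each one is a unique sequence. *)
Definition is_partition (nu : seq nat) : bool :=
  sorted geq nu && (0%N \notin nu).

Definition is_partition_of (d : nat) (nu : seq nat) : bool :=
  is_partition nu && (sumn nu == d).

Definition fat_staircase (alpha : seq nat) : seq nat :=
  flatten [seq nseq (cpart alpha i) i | i <- rev (iota 1 (size alpha))].

Definition is_fat_staircase (nu : seq nat) : Prop :=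
  exists2 beta : seq nat, is_composition beta & nu = fat_staircase beta.

(* Boxes of rho / kappa as (row, column), both numbered from 0; since rho is a
   partition, its first part [head 0 rho] bounds the number of columns. *)
Definition skew_box (rho kappa : seq nat) : predArgType :=
  {b : 'I_(size rho) * 'I_(head 0%N rho)
     | (nth 0%N kappa b.1 <= b.2 < nth 0%N rho b.1)%N}.

Definition box_row rho kappa (b : skew_box rho kappa) : nat := (val b).1.
Definition box_col rho kappa (b : skew_box rho kappa) : nat := (val b).2.

Definition semistandard (N : nat) (rho kappa : seq nat)
    (T : {ffun skew_box rho kappa -> 'I_N}) : bool :=
  [forall b, forall b',
     ((box_row b == box_row b') && (box_col b < box_col b')%N
        ==> (T b <= T b')%N)
     && ((box_col b == box_col b') && (box_row b < box_row b')%N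
        ==> (T b < T b')%N)].

Definition skew_schur (N : nat) (rho kappa : seq nat) : {mpoly int[N]} :=
  \sum_(T : {ffun skew_box rho kappa -> 'I_N} | semistandard T)
     \prod_(b : skew_box rho kappa) 'X_(T b).

Definition schur (N : nat) (nu : seq nat) : {mpoly int[N]} :=
  skew_schur N nu [::].

(* [c] is the family nu |-> c_{kappa nu}^rho of coefficients in
   s_{rho / kappa} = \sum_nu c nu s_nu. A symmetric function is identified with
   its images in all finite numbers N of variables; [c] does not depend on N.
   A partition of d has at most d parts, each at most d, so the sum ranges
   over all partitions of d. As Schur functions are linearly independent, [c]
   is unique. *)
Definition is_schur_expansion (rho kappa : seq nat) (c : seq nat -> int)
    : Prop :=
  let d := (sumn rho - sumn kappa)%N in
  (forall nu, ~~ is_partition_of d nu -> c nu = 0) /\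
  (forall N : nat,
     skew_schur N rho kappa =
     \sum_(nu : d.-bseq 'I_d.+1 | is_partition_of d (map val nu))
        c (map val nu) *: schur N (map val nu)).

Definition sum_of_fat_staircases (rho kappa : seq nat) : Prop :=
  exists2 c : seq nat -> int, is_schur_expansion rho kappa c &
    forall nu, is_partition nu -> ~ is_fat_staircase nu -> c nu = 0.

(* Main.v *)
Require Import Defs.
From mathcomp Require Import all_boot all_order all_algebra.
From mathcomp Require Import mpoly zify ring.

(* Pieri's rule, in its dual form, says that [s_{rho / (1^m)}] is the sum of the
   [s_nu] over the partitions [nu] such that [rho / nu] is a vertical strip of
   size [m]. Reading a tableau one letter at a time turns [s_{r / k}] into a
   product of horizontal-strip operators, and the rule says that these commute
   with the vertical-strip operator. That is a count of intermediate shapes: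
   for fixed outer and inner shapes both counts have a generating function that
   is a product over rows, and the two products telescope to each other.
   As Schur functions are linearly independent, [delta_alpha / (1^m)] is a sum of
   fat staircases iff every such [nu] is a fat staircase, i.e. has consecutive
   rows (including the empty one after the last) differing by at most 1. A
   vertical strip makes a gap of 2 exactly when, for some [j < n], it shortens all
   [alpha_j] rows of length [j] and none of the [alpha_{j+1}] rows of length
   [j+1]; such strips exist for the sizes from [alpha_j] to
   [|alpha| - alpha_{j+1}]. *)

Set Implicit Arguments.
Unset Strict Implicit.
Unset Printing Implicit Defensive.

Import GRing.Theory Num.Theory.

(** * Strips and the counting identity *)

Ltac decide_if := match goal with |- context [if ?c then _ else _] =>
  first [have -> : c = true by lia | have -> : c = false by lia] end.

Section Shapes.

Variables L M : nat.

Local Notation shape := {ffun 'I_L -> 'I_M.+1}.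

(* Rows beyond the last one of the grid count as empty. *)
Definition part (u : shape) (i : nat) : nat :=
  if insub i is Some j then u j else 0.

Lemma part_ord (u : shape) (i : 'I_L) : part u i = u i.
Proof. by rewrite /part valK. Qed.

Lemma part_le (u : shape) i : part u i <= M.
Proof. by rewrite /part; case: insubP => // j _ _; rewrite -ltnS. Qed.

Lemma part_default (u : shape) i : L <= i -> part u i = 0.
Proof. by move=> le_Li; rewrite /part insubN // -leqNgt. Qed.

Definition decreasing (u : shape) := [forall i : 'I_L, part u i.+1 <= part u i].

Lemma decreasingP (u : shape) :
  reflect (forall i, part u i.+1 <= part u i) (decreasing u).
Proof.
apply: (iffP forallP) => [H i|H i]; last exact: H.
have [ltiL|leLi] := ltnP i L; first exact: (H (Ordinal ltiL)).
by rewrite part_default // leqW.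
Qed.

Lemma decreasing_leq (u : shape) i j : decreasing u -> i <= j -> part u j <= part u i.
Proof.
move/decreasingP=> H; elim: j => [|j IH]; first by rewrite leqn0 => /eqP->.
by rewrite leq_eqVlt => /orP[/eqP-> //|/IH]; apply: leq_trans.
Qed.

Definition hstrip (r u : shape) :=
  [forall i : 'I_L, part r i.+1 <= part u i <= part r i].

Definition vstrip (r u : shape) :=
  [forall i : 'I_L, part u i <= part r i <= (part u i).+1].

Definition skew_size (r u : shape) := \sum_(i < L) (part r i - part u i).

Lemma hstripP r u :
  reflect (forall i, part r i.+1 <= part u i <= part r i) (hstrip r u).
Proof.
apply: (iffP forallP) => [H i|H i]; last exact: H.
have [ltiL|leLi] := ltnP i L; first exact: (H (Ordinal ltiL)).
by rewrite !part_default // leqW.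
Qed.

Lemma vstripP r u :
  reflect (forall i, part u i <= part r i <= (part u i).+1) (vstrip r u).
Proof.
apply: (iffP forallP) => [H i|H i]; last exact: H.
have [ltiL|leLi] := ltnP i L; first exact: (H (Ordinal ltiL)).
by rewrite !part_default // leqW.
Qed.

(** The strip condition leaves a row at most two lengths, so each row sum becomes explicit. The
    guard [0 < a] keeps length 0 from being counted twice. *)
Lemma sum_near_below (R : pzSemiRingType) (P : pred nat) (F : nat -> R) a :
  a <= M ->
  (\sum_(v < M.+1 | P v && (v <= a <= v.+1)%N) F v =
   (if P a then F a else 0) + (if (0 < a)%N && P a.-1 then F a.-1 else 0))%R.
Proof.
move=> leaM.
have lta : a < M.+1 by [].
have ltb : a.-1 < M.+1 by lia.
rewrite (bigID (fun v : 'I_M.+1 => v == a :> nat)) /=; congr (_ + _)%R.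
  rewrite big_mkcond (bigD1 (Ordinal lta)) //= big1 ?addr0.
    by rewrite eqxx leqnn leqnSn !andbT.
  move=> i; rewrite -val_eqE /= => /negbTE->; by rewrite andbF.
rewrite big_mkcond (bigD1 (Ordinal ltb)) //= big1 ?addr0.
  have [->|a0] := posnP a; first by rewrite eqxx andbF.
  have -> : (a.-1 <= a <= a.-1.+1) = true by lia.
  have -> : (a.-1 == a) = false by lia.
  by rewrite /= !andbT.
move=> i; rewrite -val_eqE /= => ni.
have e : (i <= a <= i.+1) && (i != a :> nat) = false by lia.
by rewrite -andbA e andbF.
Qed.

Lemma sum_near_above (R : pzSemiRingType) (P : pred nat) (F : nat -> R) a :
  (forall v, P v -> v <= M) ->
  (\sum_(v < M.+1 | P v && (a <= v <= a.+1)%N) F v =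
   (if P a then F a else 0) + (if P a.+1 then F a.+1 else 0))%R.
Proof.
move=> PM; rewrite (bigID (fun v : 'I_M.+1 => v == a :> nat)) /=.
congr (_ + _)%R.
  case: ifPn => Pa; last first.
    by rewrite big_pred0 // => i; case: eqP => [->|]; rewrite ?(negPf Pa) ?andbF.
  have lta : a < M.+1 by rewrite ltnS PM.
  rewrite (big_pred1 (Ordinal lta)) // => i; rewrite /= -val_eqE /=.
  by case: eqP => [->|]; rewrite ?Pa ?andbF // leqnn leqnSn.
case: ifPn => Pa; last first.
  rewrite big_pred0 // => i; case Pi: (P i) => //=.
  have : i != a.+1 :> nat by apply: contraNneq Pa => <-.
  by lia.
have lta : a.+1 < M.+1 by rewrite ltnS PM.
rewrite (big_pred1 (Ordinal lta)) // => i; rewrite /= -val_eqE /=.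
have [->|ne] := eqVneq (i : nat) a.+1; first by rewrite Pa /=; lia.
by case: (P i) => //=; lia.
Qed.

Local Open Scope ring_scope.

(* [row_vh r u i] and [row_hv r u i] count the choices for row [i] of a shape
   between [r] and [u]. Each is the product of a factor for row [i] itself and a
   factor [gap] for the boundary above it, respectively below it, divided by
   [1 + 'X]. *)
Definition gap (r u : shape) (i : nat) : {poly int} :=
  if (part r i.+1 <= part u i)%N then 1 + 'X
  else if (part r i.+1 == (part u i).+1)%N then 'X else 0.

Definition gap_above (r u : shape) (i : nat) : {poly int} :=
  if i is j.+1 then gap r u j else 1 + 'X.

Definition row_ok_above (u : shape) (i : nat) : pred nat :=
  fun v => ((part u i <= v) && (if i is j.+1 then v <= part u j else true))%N.

Definition row_vh (r u : shape) (i : nat) : {poly int} :=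
  \sum_(v < M.+1 | row_ok_above u i v && (v <= part r i <= v.+1)%N)
     'X^(part r i - v).

Definition row_hv (r u : shape) (i : nat) : {poly int} :=
  \sum_(v < M.+1 | (part r i.+1 <= v <= part r i)%N && (part u i <= v <= (part u i).+1)%N)
     'X^(v - part u i).

Lemma row_vh_gap r u i : decreasing r -> decreasing u ->
  row_vh r u i * gap r u i = gap_above r u i * row_hv r u i.
Proof.
move=> /decreasingP dr /decreasingP du; rewrite /row_vh /row_hv.
rewrite (sum_near_below (row_ok_above u i) (fun v => 'X^(part r i - v)) (part_le r i)).
rewrite (@sum_near_above _ (fun v => (part r i.+1 <= v <= part r i)%N)
           (fun v => 'X^(v - part u i))); last first.
  by move=> v /andP[_ vr]; exact: leq_trans vr (part_le _ _).
rewrite /row_ok_above /gap_above /gap !subnn !expr0.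
have -> : ((part u i).+1 - part u i = 1)%N by lia.
have := dr i; have := du i.
have pos a : (0 < a)%N -> (a - a.-1 = 1)%N by lia.
have := pos (part r i).
case: i => [|i].
  move: (part r 0) (part r 1) (part u 0) (part u 1) => r0 r1 u0 u1 hp h1 h2.
  by case: (ltngtP u0 r0) => h3; case: (ltngtP r1 u0.+1) => h4;
    repeat decide_if; rewrite ?expr1 ?hp ?expr1; (ring || lia).
have := dr i; have := du i.
move: (part r i) (part r i.+1) (part r i.+2) (part u i) (part u i.+1) (part u i.+2).
move=> r0 r1 r2 u0 u1 u2 h0 h0' hp h1 h2.
(* These three comparisons, for the row itself and the boundaries below and above it, decide every
   summand and boundary factor. *)
by case: (ltngtP u1 r1) => h3; case: (ltngtP r2 u1.+1) => h4;
  case: (ltngtP r1 u0.+1) => h5;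
  repeat decide_if; rewrite ?expr1 ?hp ?expr1; (ring || lia).
Qed.

(** With [r] and [u] fixed, the two strip conditions constrain the rows of [v] independently, so the
    sum over [v] factors over rows. *)
Lemma prod_row_vh r u :
  \prod_(i < L) row_vh r u i =
  \sum_(v : shape | vstrip r v && hstrip v u) 'X^(skew_size r v).
Proof.
rewrite /row_vh bigA_distr_big_dep /=; apply: eq_big => [v|v _]; last first.
  by rewrite /skew_size -prodrXr; apply: eq_bigr => i _; rewrite (part_ord v).
apply/familyP/andP => [H|[/vstripP Hv /hstripP Hh] i]; last first.
  rewrite unfold_in /row_ok_above -(part_ord v).
  have := Hv i; have := Hh i.
  by case: (i : nat) => [|j]; last have := Hh j; lia.
split; apply/forallP => i; have := H i; rewrite unfold_in /row_ok_above -(part_ord v).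
  by case/andP.
(* The remaining bound, of row [i.+1] of [v] by row [i] of [u], is recorded in the condition on row
   [i.+1]; below the grid it is trivial. *)
case/andP=> /andP[-> _] _; rewrite andbT.
have [lt|le] := ltnP i.+1 L; last by rewrite part_default.
have := H (Ordinal lt); rewrite unfold_in /row_ok_above -(part_ord v) /=.
by case/andP=> /andP[].
Qed.

Lemma prod_row_hv r u :
  \prod_(i < L) row_hv r u i =
  \sum_(v : shape | hstrip r v && vstrip v u) 'X^(skew_size v u).
Proof.
rewrite /row_hv bigA_distr_big_dep /=; apply: eq_big => [v|v _]; last first.
  by rewrite /skew_size -prodrXr; apply: eq_bigr => i _; rewrite (part_ord v).
apply/familyP/andP => [H|[/hstripP Hh /vstripP Hv] i]; last first.
  by rewrite unfold_in -(part_ord v) Hh Hv.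
by split; apply/forallP => i; have := H i; rewrite unfold_in -(part_ord v) => /andP[].
Qed.

Lemma prod_rows r u : decreasing r -> decreasing u ->
  \prod_(i < L) row_vh r u i = \prod_(i < L) row_hv r u i.
Proof.
move=> dr du; apply: (@mulIf _ (1 + 'X)).
  by rewrite addrC -size_poly_eq0 size_XaddC.
have telescope k : \prod_(i < k) row_vh r u i * gap_above r u k =
                   \prod_(i < k) row_hv r u i * (1 + 'X).
  elim: k => [|k IH]; first by rewrite !big_ord0.
  by rewrite !big_ord_recr /= -mulrA row_vh_gap // mulrA IH mulrAC.
rewrite -telescope; congr (_ * _).
(* The lowest boundary factor is [1 + 'X] too, because row [L] of [r] is empty; for [L = 0] it is
   the topmost one. *)
case: L (part_default r) => //= n r0.
by rewrite /gap r0.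
Qed.

(** The exponent of ['X] records the size of the vertical strip, so comparing coefficients at [m] in
    [prod_rows] gives an equality of counts. *)
Lemma card_vstrip_hstrip r u m : decreasing r -> decreasing u ->
  #|[pred v : shape | [&& vstrip r v, hstrip v u & skew_size r v == m]]| =
  #|[pred v : shape | [&& hstrip r v, vstrip v u & skew_size v u == m]]|.
Proof.
move=> dr du; have := congr1 (fun p : {poly int} => p`_m) (prod_rows dr du).
rewrite prod_row_vh prod_row_hv !coef_sum.
have aux (P : pred shape) (s : shape -> nat) :
   \sum_(v | P v) 'X^(s v)`_m = #|[pred v | P v && (s v == m)]|%:R :> int.
  rewrite -sum1_card natr_sum big_mkcondr /=; apply: eq_bigr => v _.
  by rewrite coefXn eq_sym; case: eqP.
rewrite !aux => /eqP; rewrite eqr_nat => /eqP e.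
rewrite -[LHS](eq_card (A := [pred v | (vstrip r v && hstrip v u) && (skew_size r v == m)])) ?e.
  by apply: eq_card => v; rewrite !inE andbA.
by move=> v; rewrite !inE andbA.
Qed.

End Shapes.

(** * Tableaux on a fixed grid *)

(** A downward closed set of ordinals is an initial segment, so its cardinality decides membership.
    This lets a row of boxes be recorded by its length. *)
Lemma card_initial n (P : pred 'I_n) :
  (forall i j : 'I_n, i <= j -> P j -> P i) -> forall j : 'I_n, (j < #|P|) = P j.
Proof.
move=> down j; have initial k : k <= n -> #|[pred i : 'I_n | i < k]| = k.
  move=> lekn; rewrite -sum1_card (eq_bigl (fun i : 'I_n => i < k)) //.
  by rewrite -(big_ord_widen_cond n xpredT (fun=> 1)) // sum1_card card_ord.
have [Pj|nPj] := boolP (P j).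
  rewrite -(initial j.+1) //; apply: subset_leq_card.
  by apply/subsetP=> i; rewrite inE unfold_in ltnS => /down->.
apply/negbTE; rewrite -leqNgt -(initial j (ltnW (ltn_ord j))).
apply: subset_leq_card; apply/subsetP => i; rewrite inE unfold_in ltnNge => Pi.
by apply: contraNN nPj => /down/(_ Pi).
Qed.

Section Tableaux.

Variables L M : nat.

Local Notation shape := {ffun 'I_L -> 'I_M.+1}.
Local Notation grid := ('I_L * 'I_M)%type.

Implicit Types (r k u : shape) (b : grid).

Definition box_in r k b := part k b.1 <= b.2 < part r b.1.

Definition subshape k r := [forall i : 'I_L, part k i <= part r i].

Lemma subshapeP k r : reflect (forall i, part k i <= part r i) (subshape k r).
Proof.
apply: (iffP forallP) => [H i|H i]; last exact: H.
have [ltiL|leLi] := ltnP i L; first exact: (H (Ordinal ltiL)).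
by rewrite part_default.
Qed.

Lemma leq_part u i a : (forall j : 'I_M, j < part u i -> j < a) -> part u i <= a.
Proof.
move=> H; rewrite leqNgt; apply/negP => lta.
have ltM : a < M := leq_trans lta (part_le u i).
by have := H (Ordinal ltM) lta; rewrite /= ltnn.
Qed.

Lemma card_box_in r k : #|[pred b | box_in r k b]| = skew_size r k.
Proof.
rewrite -sum1_card (eq_bigl (fun b => box_in r k b)) //.
rewrite -(pair_big_dep xpredT (fun i j => box_in r k (i, j)) (fun _ _ => 1)) /=.
apply: eq_bigr => i _; rewrite /box_in /=.
rewrite -(big_ord_widen_cond M (fun j => part k i <= j) (fun=> 1)) ?part_le //.
rewrite -(big_geq_mkord _ _ xpredT (fun=> 1)).
by rewrite sum_nat_const_nat muln1.
Qed.

Variable K : nat.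

Local Notation filling := {ffun grid -> 'I_K.+1}.

(* Boxes outside the skew shape carry the dummy value 0, so that restricting a
   tableau to a smaller shape keeps its type. *)
Definition tableau n r k (T : filling) :=
  [forall b, if box_in r k b then T b < n else T b == ord0] &&
  [forall b, forall b', box_in r k b ==> box_in r k b' ==>
     ((b.1 == b'.1) && (b.2 < b'.2) ==> (T b <= T b')) &&
     ((b.2 == b'.2) && (b.1 < b'.1) ==> (T b < T b'))].

Lemma tableauP n r k (T : filling) :
  reflect
    [/\ forall b, box_in r k b -> T b < n,
        forall b, ~~ box_in r k b -> T b = ord0,
        forall i j j', box_in r k (i, j) -> box_in r k (i, j') -> j < j' ->
          T (i, j) <= T (i, j')
      & forall i i' j, box_in r k (i, j) -> box_in r k (i', j) -> i < i' ->
          T (i, j) < T (i', j)]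
    (tableau n r k T).
Proof.
apply: (iffP andP) => [[/forallP H /forallP H']|[H1 H2 H3 H4]].
  split=> [b rb|b /negbTE rb|i j j' rb rb' lt|i i' j rb rb' lt].
  - by have := H b; rewrite rb.
  - by have := H b; rewrite rb => /eqP.
  - have /forallP/(_ (i, j')) := H' (i, j).
    by rewrite rb rb' /= lt !eqxx /= => /andP[].
  have /forallP/(_ (i', j)) := H' (i, j).
  by rewrite rb rb' /= lt !eqxx /= => /andP[].
split; apply/forallP => b; first by case: ifPn => [/H1|/H2->].
apply/forallP => b'; case: b b' => [i j] [i' j']; apply/implyP => rb.
apply/implyP => rb'; apply/andP; split; apply/implyP => /= /andP[/eqP e lt].
  by move: rb'; rewrite -e in rb * => rb'; apply: H3.
by move: rb'; rewrite -e in rb * => rb'; apply: H4.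
Qed.

(** The shape left when the letter [n] is erased from a tableau with entries at most [n].
    Cardinalities give a shape for every filling; for tableaux the counted boxes are
    left-justified. *)
Definition level n r k (T : filling) : shape :=
  [ffun i : 'I_L => inord #|[pred j : 'I_M |
     (j < part k i) || (j < part r i) && (T (i, j) < n)]|].

Lemma levelP n r k (T : filling) (i : 'I_L) (j : 'I_M) : tableau n.+1 r k T ->
  (j < part (level n r k T) i) = (j < part k i) || (j < part r i) && (T (i, j) < n).
Proof.
case/tableauP => _ _ row _; rewrite part_ord ffunE inordK; last first.
  by rewrite ltnS -[leqRHS]card_ord max_card.
rewrite card_initial //= => j1 j2; rewrite leq_eqVlt => /predU1P[/val_inj->//|lt].
case/orP => [lt2|/andP[lt2 Tn]]; first by rewrite (ltn_trans lt lt2).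
case: ltnP => //= le1; rewrite (ltn_trans lt lt2) /=.
apply: leq_ltn_trans Tn; apply: row => //; rewrite /box_in /=.
  by rewrite le1 (ltn_trans lt lt2).
by rewrite (leq_trans le1 (ltnW lt)).
Qed.

(** Columns increase strictly and entries are at most [n], so a box with another box of the skew
    shape below it has an entry below [n]: two letters [n] never share a column. *)
Lemma level_strip n r k (T : filling) : decreasing r -> decreasing k -> subshape k r ->
  tableau n.+1 r k T ->
  hstrip r (level n r k T) && subshape k (level n r k T).
Proof.
move=> /decreasingP dr /decreasingP dk /subshapeP kr tT.
have lev := levelP _ _ tT.
apply/andP; split; apply/forallP => i; last first.
  by apply: leq_part => j; rewrite lev => ->.
apply/andP; split; apply: leq_part => j; rewrite lev; last first.
  by case/orP => [/leq_trans->//|/andP[]].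
move=> lt1; have lt0 := leq_trans lt1 (dr i).
case: ltnP => //= le0; rewrite lt0 /=.
have ltiL : i.+1 < L by rewrite ltnNge; apply: contraL lt1 => /part_default->.
have b1 : box_in r k (Ordinal ltiL, j).
  by rewrite /box_in /= lt1 (leq_trans (dk i) le0).
have b0 : box_in r k (i, j) by rewrite /box_in /= lt0 le0.
case/tableauP: tT => lt_n _ _ col.
exact: leq_trans (col _ _ _ b0 b1 (ltnSn i)) (lt_n _ b1).
Qed.

Definition fill_strip n r u (T : filling) : filling :=
  [ffun b : grid => if box_in r u b then inord n else T b].

Definition restrict u k (T : filling) : filling :=
  [ffun b : grid => if box_in u k b then T b else ord0].

Lemma fill_restrict n r u k (T : filling) : n <= K -> subshape k u -> hstrip r u ->
  tableau n.+1 r k T -> level n r k T = u ->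
  fill_strip n r u (restrict u k T) = T.
Proof.
move=> leK /subshapeP ku /hstripP ru tT; have lev := levelP _ _ tT => eu.
case/tableauP: (tT) => lt_n dflt _ _.
apply/ffunP => -[i j]; rewrite !ffunE; have := lev i j; rewrite eu /box_in /=.
have := ku i; have := ru i; have := lt_n (i, j); have := dflt (i, j).
rewrite /box_in /=.
case: ifPn => [|c1]; last case: ifPn => // c2.
  move=> c1 _ H _ h2 h3; apply/val_inj; rewrite /= inordK //.
  have /H : part k i <= j < part r i by lia.
  by lia.
by move=> H _ h1 h2 _; rewrite H //; lia.
Qed.

(** The left side is the condition produced by reindexing along [fill_strip] with inverse
    [restrict]: the fibre of [level] over [u] corresponds to the tableaux of shape [u / k] with
    entries below [n]. *)
Lemma tableau_fill_strip n r u k (T : filling) : n <= K -> decreasing r -> subshape k u ->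
  hstrip r u ->
  [&& tableau n.+1 r k (fill_strip n r u T), level n r k (fill_strip n r u T) == u
    & restrict u k (fill_strip n r u T) == T] = tableau n u k T.
Proof.
move=> leK dr /subshapeP ku /hstripP ru.
have in_rk b : box_in r k b = box_in r u b || box_in u k b.
  by case: b => i j; rewrite /box_in /=; have := ku i; have := ru i; lia.
have not_both b : box_in u k b -> box_in r u b = false.
  by case: b => i j; rewrite /box_in /=; lia.
apply/and3P/idP => [[tT /eqP eu /eqP eT]|/tableauP[lt_n dflt row col]].
  have lev := levelP _ _ tT; case/tableauP: tT => lt_n dflt row col.
  apply/tableauP; split=> [[i j] ub|b ub|i j j' ub ub' lt|i i' j ub ub' lt].
  - have := lev i j; rewrite eu ffunE not_both //; move: ub; rewrite /box_in /=.
    by have := ru i; lia.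
  - by rewrite -eT ffunE (negbTE ub).
  - have := row i j j'; rewrite !in_rk ub ub' !orbT lt !ffunE !not_both //.
    by apply.
  have := col i i' j; rewrite !in_rk ub ub' !orbT lt !ffunE !not_both //.
  by apply.
have tT : tableau n.+1 r k (fill_strip n r u T).
  apply/tableauP; split=> [b|b|i j j'|i i' j]; rewrite ?in_rk ?ffunE.
  - by case: ifP => [_|_ /= /lt_n /ltnW]; rewrite ?inordK.
  - by rewrite negb_or => /andP[/negbTE-> /dflt].
  - move=> b b' lt; case: ifPn => bu.
      have -> : box_in r u (i, j') by move: b b' bu; rewrite /box_in /=; lia.
      by [].
    rewrite (negbTE bu) /= in b; case: ifPn => bu'.
      by rewrite inordK // ltnW // lt_n.
    by rewrite (negbTE bu') /= in b'; apply: row.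
  (* An upper box in the strip would have column at least [part u i], hence at least [part r i.+1],
     leaving no box of [r] below it in that column. *)
  move=> b b' lt; have bu : box_in r u (i, j) = false.
    apply/negbTE; rewrite /box_in /= negb_and -ltnNge; apply/orP; left.
    have := ru i; have := decreasing_leq dr lt; have := ku i'; have := ru i'.
    by move: b'; rewrite /box_in /=; lia.
  rewrite bu; rewrite bu /= in b; case: ifPn => bu'; first by rewrite inordK // lt_n.
  by rewrite (negbTE bu') /= in b'; apply: col.
split=> //; last first.
  apply/eqP/ffunP => b; rewrite !ffunE; case: ifPn => [/not_both->//|nb].
  by rewrite dflt.
apply/eqP/ffunP => i; apply/val_inj; rewrite /= -!part_ord; apply/eqP.
have lev := levelP _ _ tT.
have same (j : 'I_M) : (j < part (level n r k (fill_strip n r u T)) i) = (j < part u i).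
  rewrite lev ffunE; have := ku i; have := ru i.
  case: ifPn => [|b]; first by rewrite /box_in /= inordK //; lia.
  have := lt_n (i, j); move: b; rewrite /box_in /=.
  by case: (leqP (part k i) j) => /= h1; case: (ltnP j (part u i)) => /= h2; lia.
by rewrite eqn_leq; apply/andP; split; apply: leq_part => j; rewrite same.
Qed.

Variables (R : comPzRingType) (x : nat -> R).

Local Open Scope ring_scope.

Definition tableau_sum n r k : R :=
  \sum_(T : filling | tableau n r k T) \prod_(b | box_in r k b) x (T b).

(** Tableaux are grouped by the shape left after erasing the largest letter; each erased box
    contributes a factor [x n]. *)
Lemma tableau_sumS n r k : (n <= K)%N ->
  decreasing r -> decreasing k -> subshape k r ->
  tableau_sum n.+1 r k =
  \sum_(u | hstrip r u && subshape k u) x n ^+ skew_size r u * tableau_sum n u k.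
Proof.
move=> leK dr dk kr; rewrite /tableau_sum.
rewrite (partition_big (level n r k) (fun u => hstrip r u && subshape k u)) /=; last first.
  by move=> T; apply: level_strip.
apply: eq_bigr => u /andP[ru ku]; rewrite big_distrr /=.
rewrite (reindex_onto (fill_strip n r u) (restrict u k)) /=; last first.
  by move=> T /andP[tT /eqP eT]; apply: fill_restrict.
apply: eq_big => [T|T].
  by rewrite -andbA tableau_fill_strip.
rewrite -andbA tableau_fill_strip // => tT.
rewrite (bigID (box_in r u)) /= -card_box_in -prodr_const; congr (_ * _).
  apply: eq_big => [[i j]|b /andP[_ b_ru]]; last by rewrite ffunE b_ru inordK.
  by rewrite inE /box_in /=; move/subshapeP/(_ i): ku; lia.
apply: eq_big => [[i j]|b /andP[_ /negbTE b_ru]]; last by rewrite ffunE b_ru.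
by rewrite /box_in /=; move/subshapeP/(_ i): ku; move/hstripP/(_ i): ru; lia.
Qed.

End Tableaux.

(** * The dual Pieri rule *)

Section DualPieri.

Variables L M K : nat.

Local Notation shape := {ffun 'I_L -> 'I_M.+1}.

Implicit Types r k u v : shape.

Definition empty_shape : shape := [ffun _ => ord0].

Lemma part_empty i : part empty_shape i = 0.
Proof. by rewrite /part; case: insub => // j; rewrite ffunE. Qed.

Definition vstrip_of m r u := [&& decreasing u, vstrip r u & skew_size r u == m].

Lemma hstrip_decreasing r u : hstrip r u -> decreasing r && decreasing u.
Proof.
move/hstripP=> H; apply/andP; split; apply/decreasingP => i; have := H i.
  by move=> /andP[]; apply: leq_trans.
by have /andP[_] := H i.+1; move=> ? /andP[+ _]; apply: leq_trans.
Qed.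

Lemma hstrip_subshape r u : hstrip r u -> subshape u r.
Proof. by move/hstripP=> H; apply/subshapeP => i; have /andP[] := H i. Qed.

Lemma vstrip_subshape r u : vstrip r u -> subshape u r.
Proof. by move/vstripP=> H; apply/subshapeP => i; have /andP[] := H i. Qed.

Lemma subshape_trans u r k : subshape k u -> subshape u r -> subshape k r.
Proof.
move=> /subshapeP ku /subshapeP ur; apply/subshapeP => i.
exact: leq_trans (ku i) (ur i).
Qed.

Lemma empty_subshape r : subshape empty_shape r.
Proof. by apply/subshapeP => i; rewrite part_empty. Qed.

Lemma empty_decreasing : decreasing empty_shape.
Proof. by apply/decreasingP => i; rewrite !part_empty. Qed.

Lemma skew_sizeD r u k : subshape k u -> subshape u r ->
  skew_size r k = skew_size r u + skew_size u k.
Proof.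
move=> /subshapeP ku /subshapeP ur; rewrite /skew_size -big_split /=.
by apply: eq_bigr => i _; have := ku i; have := ur i; lia.
Qed.

Local Open Scope ring_scope.

Variables (R : comPzRingType) (x : nat -> R).

Local Notation tab_sum := (@tableau_sum L M K R x).

(** Rows of a vertical strip over the empty shape have length at most 1, so a decreasing one is a
    single column, determined by its size. *)
Lemma part_column k m (i : 'I_L) : decreasing k -> vstrip k empty_shape ->
  skew_size k empty_shape = m -> part k i = (i < m)%N.
Proof.
move=> dk /vstripP kv sk.
have le1 j : (part k j <= 1)%N by have /andP[_] := kv j; rewrite part_empty.
have -> : m = #|[pred j : 'I_L | 0 < part k j]|%N.
  rewrite -sk -sum1_card big_mkcond; apply: eq_bigr => j _; rewrite part_empty inE.
  by have := le1 j; case: (part k j) => [|[]].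
rewrite card_initial => [|j j' lejj'] /=.
  by have := le1 i; case: (part k i) => [|[]].
by move/leq_trans; apply; apply: decreasing_leq.
Qed.

Lemma tableau_sum0 r k : subshape k r -> tab_sum 0 r k = (r == k)%:R.
Proof.
move=> /subshapeP kr; rewrite /tableau_sum; case: eqVneq => [->|/eqP neq_rk].
  have none b : box_in k k b = false by rewrite /box_in; lia.
  rewrite (big_pred1 [ffun _ => ord0]) => [|T] /=; first by rewrite big_pred0.
  apply/tableauP/eqP => [[_ dflt _ _]|->].
    by apply/ffunP => b; rewrite ffunE dflt ?none.
  by split=> [b|b|i j j'|i i' j]; rewrite ?none // ffunE.
rewrite big_pred0 // => T; apply/negP => /tableauP[no_box _ _ _].
case: neq_rk; apply/ffunP => i; apply/val_inj; rewrite /= -!part_ord.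
apply/eqP; rewrite eqn_leq kr andbT; apply: leq_part => j lt.
rewrite ltnNge; apply/negP => le.
by have := no_box (i, j); rewrite /box_in /= lt le => /(_ isT).
Qed.

(** Induction on the number of letters: erasing the largest letter removes a horizontal strip, which
    [card_vstrip_hstrip] exchanges with the vertical strip. The left sum has at most one term;
    keeping it a sum covers intermediate shapes too short for the column. *)
Lemma tableau_sum_columns n r m : (n <= K.+1)%N -> decreasing r ->
  \sum_(k | [&& decreasing k, vstrip k empty_shape, skew_size k empty_shape == m
                & subshape k r]) tab_sum n r k =
  \sum_(v | vstrip_of m r v) tab_sum n v empty_shape.
Proof.
elim: n r => [|n IH] r leK dr.
  (* Without letters, both sides test whether [r] itself is a column of size [m]. *)
  transitivity (\sum_(k | [&& decreasing k, vstrip k empty_shape,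
       skew_size k empty_shape == m & subshape k r]) (r == k)%:R : R).
    by apply: eq_bigr => k /and4P[_ _ _ /tableau_sum0].
  transitivity (\sum_(v | vstrip_of m r v) (v == empty_shape)%:R : R); last first.
    by apply: eq_bigr => v _; rewrite tableau_sum0 ?empty_subshape.
  rewrite big_mkcond (bigD1 r) //= big1 => [|k /negbTE]; last first.
    by rewrite eq_sym => ->; case: ifP.
  rewrite [RHS]big_mkcond (bigD1 empty_shape) //= [X in _ = _ + X]big1 => [|k /negbTE->].
    rewrite !eqxx dr /vstrip_of empty_decreasing /= !addr0.
    by rewrite (introT (subshapeP r r)) // andbT.
  by case: ifP.
transitivity (\sum_(u | hstrip r u) \sum_(v | vstrip_of m u v)
    x n ^+ skew_size r u * tab_sum n v empty_shape).
  under eq_bigr => k /and4P[dk _ _ kr] do rewrite tableau_sumS //.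
  rewrite (exchange_big_dep (hstrip r)) /=; last by move=> ? ? _ /andP[].
  apply: eq_bigr => u ru; have /andP[_ du] := hstrip_decreasing ru.
  rewrite -!big_distrr -(IH u (ltnW leK) du) /=; congr (_ * _).
  apply: eq_bigl => k; rewrite ru /=; apply/andP/and4P => [[/and4P[-> -> -> _] ->]//|].
  by case=> -> -> -> ku; rewrite (subshape_trans ku (hstrip_subshape ru)).
(* Normal form of both sides: the shape left at the end, weighted by the number of intermediate
   shapes. The horizontal strip has size [skew_size r v - m] whichever strip is removed first. *)
transitivity (\sum_(v | decreasing v) x n ^+ (skew_size r v - m) *
    tab_sum n v empty_shape *+
    #|[pred u | [&& hstrip r u, vstrip u v & skew_size u v == m]]|).
  rewrite (exchange_big_dep (@decreasing L M)) /=; last by move=> ? ? _ /and3P[].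
  apply: eq_bigr => v dv; rewrite -sumr_const; apply: eq_big => [u|u].
    by rewrite inE /vstrip_of dv.
  case/andP=> /hstrip_subshape ur /and3P[_ /vstrip_subshape uv /eqP e].
  by rewrite (skew_sizeD uv ur) e addnK.
symmetry.
under eq_bigr => v /and3P[dv _ _] do
  rewrite tableau_sumS ?empty_decreasing ?empty_subshape //.
rewrite (exchange_big_dep (@decreasing L M)) /=; last first.
  by move=> v u _ /andP[/hstrip_decreasing/andP[]].
apply: eq_bigr => u du; rewrite -card_vstrip_hstrip // -sumr_const.
apply: eq_big => [v|v].
  rewrite inE /vstrip_of empty_subshape andbT; apply/andP/and3P => [[/and3P[]//]|].
  by case=> -> vu ->; rewrite vu; have /andP[->] := hstrip_decreasing vu.
case/andP=> /and3P[_ /vstrip_subshape vr /eqP e] /andP[/hstrip_subshape uv _].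
by rewrite (skew_sizeD uv vr) e addKn.
Qed.

Lemma tableau_sum_column n r k m : (n <= K.+1)%N -> decreasing r ->
  decreasing k -> vstrip k empty_shape -> skew_size k empty_shape = m ->
  subshape k r ->
  tab_sum n r k = \sum_(v | vstrip_of m r v) tab_sum n v empty_shape.
Proof.
move=> leK dr dk kv sk kr; rewrite -tableau_sum_columns // (big_pred1 k) // => k' /=.
apply/and4P/eqP => [[dk' kv' /eqP sk' _]|->]; last by rewrite sk.
apply/ffunP => i; apply/val_inj; rewrite /= -!part_ord.
by rewrite (part_column i dk' kv' sk') (part_column i dk kv sk).
Qed.

End DualPieri.

(** * Partitions as sequences *)

Lemma geq_trans : transitive geq.
Proof. by move=> b a c ba cb; apply: leq_trans cb ba. Qed.

Lemma partition_nth_leq nu i j : is_partition nu -> i <= j ->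
  nth 0 nu j <= nth 0 nu i.
Proof.
case/andP=> s_nu _ leij; have [ltj|] := ltnP j (size nu); last first.
  by move/(nth_default _)->.
apply: (sorted_leq_nth geq_trans leqnn 0 s_nu) => //; rewrite inE //.
exact: leq_ltn_trans leij ltj.
Qed.

Lemma partition_nth_gt0 nu i : is_partition nu -> (0 < nth 0 nu i) = (i < size nu).
Proof.
case/andP=> _ nu0; have [lti|/(nth_default _)->//] := ltnP i (size nu).
by rewrite lt0n; apply: contraNneq nu0 => <-; apply: mem_nth.
Qed.

Lemma partition_eq nu mu : is_partition nu -> is_partition mu ->
  (forall i, nth 0 nu i = nth 0 mu i) -> nu = mu.
Proof.
move=> p_nu p_mu eq_nth; apply: (@eq_from_nth _ 0) => [|i _]; last exact: eq_nth.
apply/eqP; rewrite eqn_leq; apply/andP; split; rewrite leqNgt.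
  by rewrite -(partition_nth_gt0 _ p_nu) eq_nth partition_nth_gt0 // ltnn.
by rewrite -(partition_nth_gt0 _ p_mu) -eq_nth partition_nth_gt0 // ltnn.
Qed.

Lemma sumn_nth L nu : size nu <= L -> sumn nu = \sum_(i < L) nth 0 nu i.
Proof.
move=> leL; rewrite sumnE (big_nth 0) big_mkord (big_ord_widen L (nth 0 nu)) //.
rewrite big_mkcond; apply: eq_bigr => i _.
by case: ltnP => // /(nth_default _)->.
Qed.

Lemma antitone_partition L (f : nat -> nat) :
  (forall i, f i.+1 <= f i) -> f L = 0 ->
  exists nu, [/\ is_partition nu, size nu <= L & forall i, nth 0 nu i = f i].
Proof.
move=> df fL; have ex0 : exists i, f i == 0 by exists L; rewrite fL.
case: (ex_minnP ex0) => p /eqP fp minp.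
have eq_nth i : nth 0 (mkseq f p) i = f i.
  have [lti|lei] := ltnP i p; first by rewrite nth_mkseq.
  rewrite nth_default ?size_mkseq //; elim: i lei => [|i IH].
    by rewrite leqn0 => /eqP p0; rewrite -p0 fp.
  rewrite leq_eqVlt => /predU1P[<- //|/IH fi].
  by apply/esym/eqP; rewrite -leqn0 fi.
exists (mkseq f p); split=> //; last by rewrite size_mkseq minp // fL.
apply/andP; split; first by apply/(sortedP 0) => i _; rewrite !eq_nth; apply: df.
apply/mapP => -[i]; rewrite mem_iota /= add0n => lti /esym/eqP/minp.
by rewrite leqNgt lti.
Qed.

(** * Skew Schur polynomials as tableau sums on a grid *)

Section ShapeOf.

Variables L M : nat.

Local Notation shape := {ffun 'I_L -> 'I_M.+1}.

Definition shape_of (nu : seq nat) : shape := [ffun i : 'I_L => inord (nth 0 nu i)].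

Lemma part_shape_of nu i : size nu <= L -> (forall i, nth 0 nu i <= M) ->
  part (shape_of nu) i = nth 0 nu i.
Proof.
move=> leL leM; have [lt|le] := ltnP i L.
  by rewrite (part_ord _ (Ordinal lt)) ffunE inordK ?ltnS.
by rewrite part_default // nth_default // (leq_trans leL).
Qed.

Lemma shape_of_nil : shape_of [::] = empty_shape L M.
Proof. by apply/ffunP => i; rewrite !ffunE nth_nil; apply/val_inj; rewrite /= inordK. Qed.

Lemma decreasing_partition (v : shape) : decreasing v ->
  exists nu, [/\ is_partition nu, size nu <= L & forall i, nth 0 nu i = part v i].
Proof.
by move/decreasingP => dv; apply: antitone_partition; rewrite // part_default.
Qed.

Variables (N : nat) (rho kappa : seq nat).
Hypotheses (rhoL : size rho <= L) (rhoM : head 0 rho <= M) (p_rho : is_partition rho).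
Hypotheses (kappaL : size kappa <= L) (kappaM : forall i, nth 0 kappa i <= M).

Local Notation r := (shape_of rho).
Local Notation k := (shape_of kappa).
Local Notation box := (skew_box rho kappa).

Lemma rho_nth_leq i : nth 0 rho i <= M.
Proof. by apply: leq_trans rhoM; rewrite -nth0 partition_nth_leq. Qed.

Definition box_grid (b : box) : 'I_L * 'I_M :=
  (widen_ord rhoL (val b).1, widen_ord rhoM (val b).2).

Lemma box_grid_inj : injective box_grid.
Proof.
case=> -[i j] ij [[i' j'] ij'] [/= ei ej].
by apply/val_inj; congr pair; apply/val_inj.
Qed.

Lemma box_in_shape_of c :
  box_in r k c = (nth 0 kappa c.1 <= c.2 < nth 0 rho c.1).
Proof. by rewrite /box_in !part_shape_of //; apply: rho_nth_leq. Qed.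

Lemma box_grid_in b : box_in r k (box_grid b).
Proof. by rewrite box_in_shape_of; apply: (valP b). Qed.

Lemma box_grid_onto c : box_in r k c -> exists b, box_grid b = c.
Proof.
rewrite box_in_shape_of; case: c => i j /= ij; have /andP[_ lt] := ij.
have lti : i < size rho.
  by rewrite -partition_nth_gt0 //; apply: leq_ltn_trans lt.
have ltj : j < head 0 rho.
  by apply: leq_trans lt _; rewrite -nth0 partition_nth_leq.
exists (exist _ (Ordinal lti, Ordinal ltj) ij).
by congr pair; apply/val_inj.
Qed.

Local Notation filling := {ffun 'I_L * 'I_M -> 'I_N.+1}.

(** Entries keep their values. The larger codomain ['I_N.+1] provides the dummy value 0 even when
    [N = 0]. *)
Definition grid_filling (T : {ffun box -> 'I_N}) : filling :=
  [ffun c => if [pick b | box_grid b == c] is Some b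
             then widen_ord (leqnSn N) (T b) else ord0].

Lemma grid_filling_box T b : grid_filling T (box_grid b) = T b :> nat.
Proof.
rewrite ffunE; case: pickP => [b' /eqP/box_grid_inj->//|/(_ b)].
by rewrite eqxx.
Qed.

Lemma grid_filling_out T c : ~~ box_in r k c -> grid_filling T c = ord0.
Proof.
rewrite ffunE; case: pickP => // b /eqP <-.
by rewrite box_grid_in.
Qed.

Lemma grid_filling_inj : injective grid_filling.
Proof.
move=> T T' eT; apply/ffunP => b; apply/val_inj => /=.
by rewrite -!grid_filling_box eT.
Qed.

Lemma tableau_grid_filling T :
  tableau N r k (grid_filling T) = semistandard T.
Proof.
apply/tableauP/forallP => [[_ _ row col] b|ssT].
  apply/forallP => b'; apply/andP; split; apply/implyP => /andP[/eqP e lt].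
    rewrite -!grid_filling_box; have eb : box_grid b = ((box_grid b').1, (box_grid b).2).
      by congr pair; apply/val_inj.
    have eb' : box_grid b' = ((box_grid b').1, (box_grid b').2) by [].
    by rewrite eb eb' row // -?eb -?eb' ?box_grid_in.
  rewrite -!grid_filling_box; have eb : box_grid b = ((box_grid b).1, (box_grid b').2).
    by congr pair; apply/val_inj.
  have eb' : box_grid b' = ((box_grid b').1, (box_grid b').2) by [].
  by rewrite eb eb' col // -?eb -?eb' ?box_grid_in.
split=> [c|c|i j j'|i i' j].
- by case/box_grid_onto => b <-; rewrite grid_filling_box.
- exact: grid_filling_out.
- case/box_grid_onto => b eb /box_grid_onto[b' eb'] lt.
  rewrite -eb -eb' !grid_filling_box; have /forallP/(_ b')/andP[/implyP H _] := ssT b.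
  have row c : box_row c = (box_grid c).1 by []; have col c : box_col c = (box_grid c).2 by [].
  by apply: H; rewrite !row !col eb eb' /= eqxx.
case/box_grid_onto => b eb /box_grid_onto[b' eb'] lt.
rewrite -eb -eb' !grid_filling_box; have /forallP/(_ b')/andP[_ /implyP H] := ssT b.
have row c : box_row c = (box_grid c).1 by []; have col c : box_col c = (box_grid c).2 by [].
by apply: H; rewrite !row !col eb eb' /= eqxx.
Qed.

Local Open Scope ring_scope.

Definition mvar (i : nat) : {mpoly int[N]} :=
  if insub i is Some j then 'X_j else 0.

Lemma skew_schur_tableau_sum :
  skew_schur N rho kappa = tableau_sum N mvar N r k.
Proof.
pose G (T : filling) := \prod_(c | box_in r k c) mvar (T c).
transitivity (\sum_(T | semistandard T) G (grid_filling T)).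
  apply: eq_bigr => T _; rewrite /G.
  rewrite (eq_bigl (mem [set box_grid b | b : box])); last first.
    move=> c; apply/idP/imsetP => [/box_grid_onto[b <-]|[b _ ->]]; last exact: box_grid_in.
    by exists b.
  rewrite big_imset /=; last by move=> ? ? _ _; apply: box_grid_inj.
  by apply: eq_bigr => b _; rewrite grid_filling_box /mvar valK.
rewrite /tableau_sum -(big_imset G) /=; last by move=> ? ? _ _; apply: grid_filling_inj.
apply: eq_bigl => T; apply/imsetP/idP => [[T' ssT' ->]|tT].
  by rewrite tableau_grid_filling.
(* A grid tableau has entries below [N] at the boxes and 0 elsewhere, so it comes from the tableau
   that reads off its box entries. *)
have lt_N b : (T (box_grid b) < N)%N.
  by case/tableauP: tT => lt_n _ _ _; apply: lt_n; apply: box_grid_in.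
have eT : grid_filling [ffun b => Ordinal (lt_N b)] = T.
  apply/ffunP => c; apply/val_inj; have [|out] := boolP (box_in r k c).
    by case/box_grid_onto => b <-; rewrite /= grid_filling_box ffunE.
  by rewrite grid_filling_out //; case/tableauP: tT => _ /(_ _ out) ->.
have ssT : semistandard [ffun b => Ordinal (lt_N b)] by rewrite -tableau_grid_filling eT.
by exists [ffun b => Ordinal (lt_N b)].
Qed.

End ShapeOf.

(** * The Schur expansion after removal of a column *)

Local Open Scope nat_scope.

Lemma nth_leq_sumn (s : seq nat) i : nth 0 s i <= sumn s.
Proof.
by elim: s i => [|a s IH] [|i] //=; [exact: leq_addr | exact: leq_trans (leq_addl _ _)].
Qed.

Lemma size_leq_sumn (s : seq nat) : 0 \notin s -> size s <= sumn s.
Proof.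
elim: s => //= a s IH; rewrite inE negb_or eq_sym -lt0n => /andP[a0 /IH].
by lia.
Qed.

Lemma partition_bseq d nu : is_partition_of d nu ->
  exists t : d.-bseq 'I_d.+1, map val t = nu.
Proof.
case/andP=> /andP[_ nu0] /eqP e.
have le_size : size (map (@inord d) nu) <= d.
  by rewrite size_map -e size_leq_sumn.
exists (Bseq le_size); rewrite /= -map_comp map_id_in // => x nux /=.
rewrite inordK // ltnS -e -(nth_index 0 nux); exact: nth_leq_sumn.
Qed.

Definition vertical_strip (rho nu : seq nat) : bool :=
  (size nu <= size rho) &&
  all (fun i => nth 0 nu i <= nth 0 rho i <= (nth 0 nu i).+1) (iota 0 (size rho)).

Lemma vertical_stripP rho nu :
  reflect (size nu <= size rho /\
           forall i, nth 0 nu i <= nth 0 rho i <= (nth 0 nu i).+1)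
          (vertical_strip rho nu).
Proof.
apply: (iffP andP) => -[le_size H]; split=> //; last first.
  by apply/allP => i _; apply: H.
move=> i; have [lti|lei] := ltnP i (size rho).
  by apply: (allP H); rewrite mem_iota.
by rewrite !nth_default // (leq_trans le_size).
Qed.

Definition column_coefficient rho m nu : int :=
  (is_partition_of (sumn rho - m) nu && vertical_strip rho nu)%:R%R.

Lemma schur_expansion_column rho m : is_partition rho -> 0 < m <= size rho ->
  is_schur_expansion rho (nseq m 1) (column_coefficient rho m).
Proof.
move=> p_rho /andP[m_gt0 le_m].
have sum_col : sumn (nseq m 1) = m by rewrite sumn_nseq mul1n.
rewrite /is_schur_expansion sum_col; set d := sumn rho - m; split=> [nu|N].
  by rewrite /column_coefficient => /negbTE->.
(* The bounding box of [rho] serves as the grid: it holds [rho], the column, and every [nu] for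
   which [rho / nu] is a vertical strip. *)
set L := size rho; set M := head 0 rho.
have M_gt0 : 0 < M.
  by rewrite /M -nth0 partition_nth_gt0 // (leq_trans m_gt0).
have rhoM i : nth 0 rho i <= M by rewrite /M -nth0 partition_nth_leq.
have nth_col i : nth 0 (nseq m 1) i = (i < m) by rewrite nth_nseq; case: ltnP.
have colL : size (nseq m 1) <= L by rewrite size_nseq.
have colM i : nth 0 (nseq m 1) i <= M by rewrite nth_col; case: ltnP.
have part_rho i : part (shape_of L M rho) i = nth 0 rho i by apply: part_shape_of.
have part_col i : part (shape_of L M (nseq m 1)) i = (i < m) by rewrite part_shape_of ?nth_col.
rewrite (@skew_schur_tableau_sum L M) // (@tableau_sum_column _ _ _ _ _ _ _ _ m) //; last first.
- apply/subshapeP => i; rewrite part_rho part_col; case: ltnP => // lt.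
  by rewrite partition_nth_gt0 // (leq_trans lt).
- rewrite /skew_size -[RHS]sum_col (sumn_nth colL); apply: eq_bigr => i _.
  by rewrite part_col part_empty subn0 nth_col.
- by apply/vstripP => i; rewrite part_col part_empty; case: ltnP.
- by apply/decreasingP => i; rewrite !part_col; lia.
- by apply/decreasingP => i; rewrite !part_rho partition_nth_leq.
have strip_bounds nu : vertical_strip rho nu ->
    size nu <= L /\ forall i, nth 0 nu i <= M.
  case/vertical_stripP => le_size H; split=> // i.
  by have /andP[le _] := H i; apply: leq_trans le (rhoM i).
(* Other partitions of [d] may not fit into the grid, but their coefficient is 0; they are dropped
   before Schur polynomials are read as grid sums. *)
transitivity (\sum_(t : d.-bseq 'I_d.+1 |
      is_partition_of d (map val t) && vertical_strip rho (map val t))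
   tableau_sum N (@mvar N) N (shape_of L M (map val t)) (empty_shape L M))%R; last first.
  rewrite big_mkcondr /=; apply: eq_bigr => t pt; rewrite /column_coefficient pt.
  case: ifPn => [/strip_bounds[le_size le_M]|]; last by rewrite scale0r.
  have /andP[part_t _] := pt.
  have headM : head 0 (map val t) <= M by rewrite -nth0.
  have nilM i : nth 0 [::] i <= M by rewrite nth_nil.
  by rewrite scale1r /schur (@skew_schur_tableau_sum L M) ?shape_of_nil.
(* Both sums run over the same shapes: [shape_of] is injective on these partitions, and every [v]
   with [vstrip_of m] comes from one. *)
rewrite -(big_imset (fun v => tableau_sum N (@mvar N) N v (empty_shape L M))
           (h := fun t : d.-bseq 'I_d.+1 => shape_of L M (map val t))) /=; last first.
  move=> t t' /andP[/andP[pt _] /strip_bounds[sz le]] /andP[/andP[pt' _] /strip_bounds[sz' le']] e.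
  apply/val_inj/(inj_map val_inj)/partition_eq => // i.
  by rewrite -(part_shape_of _ sz le) -(part_shape_of _ sz' le') e.
apply: eq_bigl => v; apply/and3P/imsetP => [[dv /vstripP rv /eqP sz_v]|].
  have [nu [p_nu nuL nth_nu]] := decreasing_partition dv.
  have vs : vertical_strip rho nu.
    by apply/vertical_stripP; split=> // i; have := rv i; rewrite part_rho nth_nu.
  have sum_nu : is_partition_of d nu.
    rewrite /is_partition_of p_nu /= /d -sz_v !(@sumn_nth L) //; apply/eqP.
    under eq_bigr do rewrite nth_nu.
    apply/esym/eqP; rewrite -(eqn_add2r (skew_size (shape_of L M rho) v)) subnK.
      rewrite -big_split; apply/eqP/eq_bigr => i _.
      by have := rv i; rewrite part_rho => /andP[le _]; rewrite /= subnKC.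
    by apply: leq_sum => i _; rewrite part_rho leq_subr.
  have [t et] := partition_bseq sum_nu.
  exists t; first by rewrite unfold_in et sum_nu.
  apply/ffunP => i; apply/val_inj; rewrite et /= -!part_ord part_shape_of ?nth_nu //.
  by move=> j; rewrite nth_nu part_le.
case=> t; rewrite unfold_in => /andP[/andP[pt /eqP sum_t] vs] ->.
move: (map val t) pt sum_t vs => nu pt sum_t vs.
have [le_size le_M] := strip_bounds _ vs.
have part_t i := part_shape_of i le_size le_M.
split.
- by apply/decreasingP => i; rewrite !part_t partition_nth_leq.
- by apply/vstripP => i; rewrite part_rho part_t; have /vertical_stripP[_] := vs; apply.
(* [d] is a truncated difference; this bound allows [m] to be recovered as [sumn rho - d]. *)
have m_le : m <= sumn rho.
  apply: leq_trans le_m (size_leq_sumn _); by have /andP[] := p_rho.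
apply/eqP; transitivity (sumn rho - d); last by rewrite /d subKn.
rewrite -sum_t !(@sumn_nth L) // /skew_size.
under eq_bigr do rewrite part_rho part_t.
rewrite -sumnB // => i _.
by have /vertical_stripP[_ /(_ i)/andP[]] := vs.
Qed.

(** * Linear independence of Schur functions *)

Section Independence.

Variable N : nat.

Implicit Types nu lambda : seq nat.

Definition exponent lambda : 'X_{1..N} := [multinom nth 0 lambda i | i < N].

(** For at most [N] parts, this is the statistic usually written n(lambda). *)
Definition row_weight lambda := \sum_(i < N) i * nth 0 lambda i.

Definition content nu (T : {ffun skew_box nu [::] -> 'I_N}) : 'X_{1..N} :=
  (\sum_b U_(T b))%MM.

Lemma contentE nu (T : {ffun skew_box nu [::] -> 'I_N}) i :
  content T i = \sum_(b | T b == i) 1.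
Proof.
rewrite /content mnm_sumE [RHS]big_mkcond; apply: eq_bigr => b _.
by rewrite mnm1E; case: eqP.
Qed.

Lemma mcoeff_schur nu lambda :
  ((schur N nu)@_(exponent lambda))%R =
  (\sum_(T : {ffun skew_box nu [::] -> 'I_N} | semistandard T)
     (content T == exponent lambda)%:R)%R.
Proof.
rewrite /schur /skew_schur raddf_sum /=; apply: eq_bigr => T _.
by rewrite -mcoeffX /content mprodXE.
Qed.

Lemma sum_content nu (T : {ffun skew_box nu [::] -> 'I_N}) :
  \sum_b (T b : nat) = \sum_(i < N) i * content T i.
Proof.
rewrite (partition_big (fun b => T b) xpredT) //=; apply: eq_bigr => i _.
rewrite contentE big_distrr /=; apply: eq_bigr => b /eqP->.
by rewrite muln1.
Qed.

Lemma card_box_row nu i : is_partition nu ->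
  \sum_(b : skew_box nu [::] | box_row b == i) 1 = nth 0 nu i.
Proof.
move=> p_nu; pose P (c : 'I_(size nu) * 'I_(head 0 nu)) :=
  (c.1 == i :> nat) && (c.2 < nth 0 nu c.1).
transitivity (\sum_(c in [set val b | b : skew_box nu [::] & box_row b == i]) 1).
  rewrite big_imset /=; last by move=> b b' _ _; apply: val_inj.
  by apply: eq_bigl => b; rewrite inE.
rewrite (eq_bigl P) => [|c]; last first.
  apply/imsetP/andP => [[b] |[/eqP ei lt]].
    by rewrite inE => bi ->; split=> //; have /andP[] := valP b.
  have bc : nth 0 [::] c.1 <= c.2 < nth 0 nu c.1 by rewrite nth_nil.
  by exists (exist _ c bc); rewrite // inE /box_row /= ei.
rewrite -(pair_big_dep (fun k : 'I_(size nu) => k == i :> nat)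
    (fun (k : 'I_(size nu)) (j : 'I_(head 0 nu)) => j < nth 0 nu k) (fun _ _ => 1)) /=.
have le_head k : nth 0 nu k <= head 0 nu by rewrite -nth0 partition_nth_leq.
under eq_bigr => k _ do
  rewrite -(big_ord_widen _ (fun=> 1)) // sum1_card card_ord.
have [lti|lei] := ltnP i (size nu); first by rewrite (big_pred1 (Ordinal lti)).
by rewrite nth_default // big1 // => k /eqP ki; have := ltn_ord k; rewrite ki ltnNge lei.
Qed.

Lemma sum_box_row nu : is_partition nu -> size nu <= N ->
  \sum_(b : skew_box nu [::]) box_row b = row_weight nu.
Proof.
move=> p_nu le_N; have lt b : @box_row nu [::] b < N.
  exact: leq_trans (ltn_ord _) le_N.
rewrite (partition_big (fun b => Ordinal (lt b)) xpredT) //=; apply: eq_bigr => i _.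
rewrite -(card_box_row _ p_nu) big_distrr /=; apply: eq_big => b.
  by rewrite -val_eqE.
by move/eqP=> <-; rewrite muln1.
Qed.

(** In a straight shape the box directly above exists and has a strictly smaller entry; induction on
    the row. *)
Lemma semistandard_row_leq nu (T : {ffun skew_box nu [::] -> 'I_N}) b :
  is_partition nu -> semistandard T -> box_row b <= T b.
Proof.
move=> p_nu ssT.
have [i] := ubnP (box_row b); elim: i b => // i IH b lt_i.
case row_b: (box_row b) => [//|a].
have lta : a < size nu.
  by apply: ltn_trans (ltnSn a) _; rewrite -row_b; apply: ltn_ord.
have bc : nth 0 [::] (Ordinal lta) <= (val b).2 < nth 0 nu (Ordinal lta).
  rewrite nth_nil /=; have /andP[_ /leq_trans] := valP b; apply.
  by rewrite -/(box_row b) row_b partition_nth_leq.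
pose b' : skew_box nu [::] := exist _ (Ordinal lta, (val b).2) bc.
have /forallP/(_ b)/andP[_ /implyP col] := forallP ssT b'.
have /col : (box_col b' == box_col b) && (box_row b' < box_row b).
  by rewrite eqxx row_b /box_row /=.
apply: leq_ltn_trans; apply: (IH b').
by rewrite -ltnS; apply: leq_trans lt_i; rewrite row_b.
Qed.

Lemma content_row nu (T : {ffun skew_box nu [::] -> 'I_N}) :
  is_partition nu -> (forall b, T b = box_row b :> nat) -> content T = exponent nu.
Proof.
move=> p_nu eT; apply/mnmP => i; rewrite contentE mnmE -(card_box_row i p_nu).
by apply: eq_bigl => b; rewrite -val_eqE /= eT.
Qed.

Lemma sum_leq_eq (I : finType) (f g : I -> nat) :
  (forall i, f i <= g i) -> \sum_i g i <= \sum_i f i -> forall i, f i = g i.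
Proof.
move=> le_fg le_sum i; apply/eqP; rewrite eqn_leq le_fg /=.
move: le_sum; rewrite (bigD1 i) //= [leqRHS](bigD1 i) //= => le_sum.
have := leq_sum (index_enum I) (P := fun j => j != i) (fun j _ => le_fg j).
by lia.
Qed.

(* Sorting by [row_weight] makes the Kostka matrix unitriangular: an entry of a
   semistandard tableau is at least its row index, so the sum of the entries is
   at least [row_weight] of the shape, with equality only for the tableau whose
   entries are their row indices. *)
Lemma mcoeff_schur_neq0 nu lambda : is_partition nu -> is_partition lambda ->
  size nu <= N -> size lambda <= N -> row_weight lambda <= row_weight nu ->
  ((schur N nu)@_(exponent lambda))%R != 0%R -> nu = lambda.
Proof.
move=> p_nu p_la nuN laN le_w; rewrite mcoeff_schur => nz.
have [T ssT /eqP eT] : exists2 T : {ffun skew_box nu [::] -> 'I_N},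
    semistandard T & content T == exponent lambda.
  apply/exists_inP; apply: contraNT nz; rewrite negb_exists => /forallP none.
  rewrite big1 // => T ssT; case: eqP => // eT.
  by have := none T; rewrite ssT eT eqxx.
have row_T : forall b, box_row b = T b.
  apply: sum_leq_eq => [b|]; first exact: semistandard_row_leq.
  rewrite sum_content sum_box_row // eT; apply: leq_trans le_w.
  by apply: leq_sum => i _; rewrite mnmE.
have e : exponent nu = exponent lambda by rewrite -eT content_row.
apply: partition_eq => // i; have [lti|lei] := ltnP i N.
  by have := congr1 (fun m : 'X_{1..N} => m (Ordinal lti)) e; rewrite !mnmE.
by rewrite !nth_default // (leq_trans _ lei).
Qed.

Lemma mcoeff_schur_diag nu : is_partition nu -> size nu <= N ->
  ((schur N nu)@_(exponent nu) = 1)%R.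
Proof.
move=> p_nu nuN; have lt b : @box_row nu [::] b < N.
  exact: leq_trans (ltn_ord _) nuN.
pose T0 : {ffun skew_box nu [::] -> 'I_N} := [ffun b => Ordinal (lt b)].
have T0E b : T0 b = box_row b :> nat by rewrite ffunE.
have ss0 : semistandard T0.
  apply/forallP=> b; apply/forallP => b'; rewrite !T0E; apply/andP; split.
    by apply/implyP => /andP[/eqP->].
  by apply/implyP => /andP[].
rewrite mcoeff_schur (bigD1 T0) //= content_row // eqxx big1 ?addr0 // => T /andP[ssT neq].
case: eqP => // eT; case/eqP: neq; apply/ffunP => b; apply/val_inj; rewrite /= T0E.
apply/esym; move: b; apply: sum_leq_eq => [b|]; first exact: semistandard_row_leq.
rewrite sum_content sum_box_row // eT.
by apply: leq_sum => i _; rewrite mnmE.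
Qed.

End Independence.

(** Choose a partition of least [row_weight] among those with nonzero coefficient: by
    unitriangularity its monomial occurs in no other such term. In [d] variables no partition of [d]
    is lost, as it has at most [d] parts. *)
Lemma schur_free d (a : seq nat -> int) :
  (\sum_(t : d.-bseq 'I_d.+1 | is_partition_of d (map val t))
      a (map val t) *: schur d (map val t) = 0)%R ->
  forall nu, is_partition_of d nu -> a nu = 0%R.
Proof.
move=> sum0 nu p_nu; apply/eqP/negPn/negP => nz; have [t et] := partition_bseq p_nu.
pose P (t : d.-bseq 'I_d.+1) := is_partition_of d (map val t) && (a (map val t) != 0%R).
have Pt : P t by rewrite /P et p_nu.
case: (arg_minnP (fun t : d.-bseq 'I_d.+1 => row_weight d (map val t)) Pt) => t1 /andP[p1 nz1] min1.
case/negP: nz1; apply/eqP.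
have le_d (s : d.-bseq 'I_d.+1) : size (map val s) <= d by rewrite size_map size_bseq.
have := congr1 (mcoeff (exponent d (map val t1))) sum0.
rewrite raddf_sum /= (bigD1 t1) //= big1 ?addr0 => [|s /andP[ps neq]].
  by rewrite mcoeff0 mcoeffZ mcoeff_schur_diag ?mulr1 //; case/andP: p1.
rewrite mcoeffZ; have [->|nzs] := eqVneq (a (map val s)) 0%R; first by rewrite mul0r.
apply/eqP; rewrite mulf_eq0 (negbTE nzs) /=; apply: contraNT neq => nzc.
apply/eqP/val_inj/(inj_map val_inj).
apply: (mcoeff_schur_neq0 _ _ (le_d s) (le_d t1) _ nzc).
- by case/andP: ps.
- by case/andP: p1.
by apply: min1; rewrite /P ps.
Qed.

Lemma schur_expansion_unique rho kappa c c' :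
  is_schur_expansion rho kappa c -> is_schur_expansion rho kappa c' -> c =1 c'.
Proof.
case=> out exp [out' exp'] nu.
set d := sumn rho - sumn kappa in out exp out' exp'.
have [p_nu|np_nu] := boolP (is_partition_of d nu); last by rewrite out ?out'.
apply/eqP; rewrite -subr_eq0; apply/eqP.
apply: (@schur_free d (fun nu => c nu - c' nu)%R _ _ p_nu).
under eq_bigr do rewrite scalerBl.
by rewrite sumrB -exp -exp' subrr.
Qed.

(** * Fat staircases *)

Lemma sorted_flatten_nseq (f : nat -> nat) (s : seq nat) :
  sorted geq s -> sorted geq (flatten [seq nseq (f i) i | i <- s]).
Proof.
rewrite !sorted_pairwise; [|exact: geq_trans..].
elim: s => //= a s IH /andP[a_s /IH ps]; rewrite pairwise_cat ps andbT.
apply/andP; split.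
  apply/allrelP => x y /nseqP[-> _] /flatten_mapP[i si /nseqP[-> _]].
  exact: (allP a_s).
elim: (f a) => //= n ->; rewrite andbT; apply/allP => x /nseqP[-> _]; exact: leqnn.
Qed.

Lemma count_mem_fat_staircase alpha v :
  count_mem v (fat_staircase alpha) =
  if 0 < v <= size alpha then cpart alpha v else 0.
Proof.
rewrite /fat_staircase count_flatten -map_comp sumnE big_map.
have in_iota i : (i \in rev (iota 1 (size alpha))) = (0 < i <= size alpha).
  by rewrite mem_rev mem_iota add1n ltnS.
case: ifPn => [v_in|v_out]; last first.
  rewrite big1_seq // => i /andP[_]; rewrite in_iota /= count_nseq /=.
  by case: eqP => [->|//]; rewrite (negbTE v_out).
rewrite (bigD1_seq v) ?in_iota ?rev_uniq ?iota_uniq //= count_nseq /= eqxx mul1n.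
by rewrite big1 ?addn0 // => i /negbTE ne; rewrite count_nseq /= ne.
Qed.

Lemma size_fat_staircase alpha : size (fat_staircase alpha) = sumn alpha.
Proof.
rewrite /fat_staircase size_flatten /shape -map_comp map_rev sumn_rev.
rewrite (sumn_nth (leqnn (size alpha))) sumnE big_map.
rewrite -[X in _ = X](big_mkord xpredT (nth 0 alpha)) -[iota 1 _]/(iota (1 + 0) _).
rewrite iotaDl big_map /index_iota subn0.
by apply: eq_bigr => i _; rewrite /= size_nseq.
Qed.

Lemma partition_fat_staircase alpha : is_partition (fat_staircase alpha).
Proof.
apply/andP; split.
  apply: sorted_flatten_nseq; rewrite rev_sorted.
  have := iota_sorted 1 (size alpha); apply: sub_sorted => a b; exact.
by rewrite -has_pred1 has_count count_mem_fat_staircase.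
Qed.

Lemma mem_fat_staircase alpha v : is_composition alpha ->
  (v \in fat_staircase alpha) = (0 < v <= size alpha).
Proof.
move=> c_alpha; rewrite -has_pred1 has_count count_mem_fat_staircase.
case: ifP => // /andP[v_gt0 le_v]; rewrite lt0n; apply/negP => /eqP cv.
by move: c_alpha; rewrite /is_composition -cv mem_nth // prednK.
Qed.

Lemma partition_index nu v : v \in nu -> exists2 k, k < size nu & nth 0 nu k = v.
Proof. by move=> nu_v; exists (index v nu); rewrite ?index_mem // nth_index. Qed.

(** Every value from 1 to the largest part occurs, whereas a gap of two would skip the value just
    above row [i.+1]. *)
Lemma fat_staircase_gap alpha i : is_composition alpha ->
  nth 0 (fat_staircase alpha) i <= (nth 0 (fat_staircase alpha) i.+1).+1.
Proof.
move=> c_alpha; set nu := fat_staircase alpha; rewrite leqNgt; apply/negP => gap.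
have p_nu : is_partition nu by apply: partition_fat_staircase.
have : nth 0 nu i \in nu by rewrite mem_nth // -partition_nth_gt0 //; lia.
rewrite mem_fat_staircase // => /andP[_ le_n].
have : (nth 0 nu i.+1).+1 \in nu by rewrite mem_fat_staircase //; lia.
case/partition_index => k _ ek.
by case: (leqP k i) => [/(partition_nth_leq p_nu)|/(partition_nth_leq p_nu)]; lia.
Qed.

(** Descending from the first part to 0 by steps of at most 1 meets every value in between, so the
    multiplicities are positive and form a composition. *)
Lemma is_fat_staircaseP nu : is_partition nu ->
  (forall i, nth 0 nu i <= (nth 0 nu i.+1).+1) -> is_fat_staircase nu.
Proof.
move=> p_nu gap; set n := head 0 nu.
have mem_nu v : 0 < v <= n -> v \in nu.
  move=> /andP[v0 vn]; have ex : exists k, nth 0 nu k <= v.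
    by exists (size nu); rewrite nth_default.
  case: (ex_minnP ex) => k le_k min_k.
  have ek : nth 0 nu k = v.
    case: k le_k min_k => [|k] le_k min_k.
      by apply/eqP; rewrite eqn_leq le_k nth0.
    have := gap k; have := min_k k; rewrite ltnn => H.
    have : ~~ (nth 0 nu k <= v) by apply/negP => /H.
    by lia.
  by rewrite -ek mem_nth // -partition_nth_gt0 // ek.
have nu_le v : v \in nu -> 0 < v <= n.
  move=> nu_v; rewrite lt0n; apply/andP; split.
    by apply: contraTneq nu_v => ->; case/andP: p_nu.
  by case/partition_index: nu_v => k _ <-; rewrite /n -nth0 partition_nth_leq.
have cpartE v : 0 < v <= n -> cpart [seq count_mem i nu | i <- iota 1 n] v = count_mem v nu.
  by move=> /andP[v0 vn]; rewrite /cpart (nth_map 0) ?nth_iota ?size_iota ?add1n ?prednK.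
exists [seq count_mem i nu | i <- iota 1 n].
  apply/mapP => -[v]; rewrite mem_iota add1n ltnS => /mem_nu.
  by rewrite -has_pred1 has_count lt0n => /eqP + e; rewrite -e.
apply: (sorted_eq geq_trans).
- by move=> a b; rewrite /geq /= -eqn_leq => /eqP.
- by case/andP: p_nu.
- by case/andP: (partition_fat_staircase [seq count_mem i nu | i <- iota 1 n]).
apply/allP => v _ /=; rewrite count_mem_fat_staircase size_map size_iota.
case: ifPn => [/cpartE->//|]; apply: contraNT => nz; apply: nu_le.
by rewrite -has_pred1 has_count lt0n.
Qed.

(** * Vertical strips and gaps of two *)

Lemma count_mem_nth (s : seq nat) v :
  count_mem v s = \sum_(i < size s) (nth 0 s i == v).
Proof.
rewrite -sum1_count (big_nth 0) big_mkord big_mkcond.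
by apply: eq_bigr => i _ /=; case: eqP.
Qed.

Lemma vertical_strip_size rho nu : vertical_strip rho nu ->
  sumn rho = sumn nu + \sum_(i < size rho) (nth 0 rho i - nth 0 nu i).
Proof.
case/vertical_stripP => le_size H.
rewrite (sumn_nth (leqnn (size rho))) (sumn_nth le_size) -big_split /=.
by apply: eq_bigr => i _; rewrite subnKC //; have /andP[] := H i.
Qed.

(* If the gap between rows [i] and [i.+1] grows to two, then row [i] is kept and
   row [i.+1] is shortened; as [nu] is a partition, so are respectively all the
   rows of length [nth 0 rho i] and all those of length [nth 0 rho i.+1]. *)
Lemma vertical_strip_gap rho nu i : is_partition rho -> is_partition nu ->
  vertical_strip rho nu -> nth 0 rho i <= (nth 0 rho i.+1).+1 ->
  (nth 0 nu i.+1).+1 < nth 0 nu i ->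
  let j := nth 0 rho i.+1 in
  [/\ 0 < j, nth 0 rho i = j.+1, count_mem j rho + sumn nu <= sumn rho
    & sumn rho + count_mem j.+1 rho <= sumn nu + size rho].
Proof.
move=> p_rho p_nu vs gap_rho gap_nu j; have /vertical_stripP[_ H] := vs.
have [e_nu ei e1 j_gt0] : [/\ nth 0 nu i.+1 = j.-1, nth 0 rho i = j.+1,
    nth 0 nu i = j.+1 & 0 < j].
  by move: (H i) (H i.+1); rewrite -/j; split; lia.
split=> //.
  (* Rows of length [j] lie below row [i], where [nu] has parts at most [j.-1]; each of them loses a
     box. *)
  rewrite (vertical_strip_size vs) addnC leq_add2l count_mem_nth.
  apply: leq_sum => k _; case: eqP => // rho_k.
  case: (leqP k i) => [/(partition_nth_leq p_rho)|/(partition_nth_leq p_nu)]; lia.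
(* Each row contributes at most 1: it loses a box or has length [j.+1], but not both, as rows of
   length [j.+1] are kept. *)
rewrite (vertical_strip_size vs) -addnA leq_add2l count_mem_nth -big_split /=.
rewrite -[leqRHS]card_ord -sum1_card; apply: leq_sum => k _; have := H k.
case: eqP => [rho_k|]; last by lia.
by case: (leqP k i) => [/(partition_nth_leq p_nu)|/(partition_nth_leq p_rho)]; lia.
Qed.

(** At the first [q] with [g q <= m], the preceding value exceeds [m] and the drop is at most 1. *)
Lemma discrete_ivt (g : nat -> nat) m L :
  (forall q, g q <= (g q.+1).+1) -> g L <= m <= g 0 -> exists q, g q = m.
Proof.
move=> step /andP[gL g0]; have ex : exists q, g q <= m by exists L.
case: (ex_minnP ex) => q le_q min_q; exists q; apply/eqP; rewrite eqn_leq le_q /=.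
case: q le_q min_q => // q le_q min_q; rewrite -ltnS; apply: leq_trans (step q).
by rewrite ltnNge; apply/negP => /min_q; rewrite ltnn.
Qed.

(* Shorten all rows of length [j], none of length [j.+1], and among the other
   rows those from some row [q] on; lowering [q] one row at a time reaches every
   size between the two extremes. *)
Lemma vertical_strip_with_gap rho j m : is_partition rho -> 0 < j ->
  j \in rho -> j.+1 \in rho ->
  count_mem j rho <= m <= size rho - count_mem j.+1 rho ->
  exists2 nu, [/\ is_partition nu, vertical_strip rho nu & sumn rho = sumn nu + m]
            & exists i, (nth 0 nu i.+1).+1 < nth 0 nu i.
Proof.
move=> p_rho j_gt0 rho_j rho_j1 bounds; set L := size rho.
pose low q k := (nth 0 rho k == j) || (q <= k) && (nth 0 rho k != j.+1).
pose g q := \sum_(k < L) low q k.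
have step q : g q <= (g q.+1).+1.
  have le1 : \sum_(k < L) (k == q :> nat) <= 1.
    have [lt|le] := ltnP q L.
      rewrite (bigD1 (Ordinal lt)) //= eqxx big1 // => k.
      by rewrite -val_eqE /= => /negbTE->.
    by rewrite big1 // => k _; have := ltn_ord k; case: eqP => //; lia.
  rewrite -addn1; apply: leq_trans (leq_add (leqnn _) le1).
  rewrite /g -big_split /=; apply: leq_sum => k _; rewrite /low.
  by case: (nth 0 rho k == j) => //=; case: (nth 0 rho k != _); rewrite ?andbF ?andbT //; lia.
have gL : g L = count_mem j rho.
  rewrite count_mem_nth; apply: eq_bigr => k _.
  by rewrite /low leqNgt ltn_ord orbF.
have g0 : g 0 + count_mem j.+1 rho = L.
  rewrite count_mem_nth -big_split /= -[RHS]card_ord -sum1_card.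
  apply: eq_bigr => k _; rewrite /low /=; move: (nth 0 rho k) => x.
  by have [->|_] := eqVneq x j; [rewrite ltn_eqF|case: eqVneq].
have [q gq] : exists q, g q = m by apply: (discrete_ivt step (L := L)); lia.
have rho_anti k : nth 0 rho k.+1 <= nth 0 rho k by rewrite partition_nth_leq.
have low_le k : nth 0 rho k - low q k <= nth 0 rho k <= (nth 0 rho k - low q k).+1.
  by case: (low q k); lia.
have [nu [p_nu nuL nu_nth]] : exists nu,
    [/\ is_partition nu, size nu <= L & forall k, nth 0 nu k = nth 0 rho k - low q k].
  apply: antitone_partition => [k|]; last by rewrite nth_default.
  (* Among rows of equal length, once one is shortened so are all later ones; across a strict drop
     the loss of one box does no harm. *)
  have := rho_anti k; rewrite leq_eqVlt => /predU1P[e|lt].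
    rewrite e leq_sub2l // /low e; case: (nth 0 rho k == j) => //=.
    by case: (nth 0 rho k != _); rewrite ?andbF ?andbT //; lia.
  by case: (low q k); case: (low q k.+1); lia.
have vs : vertical_strip rho nu by apply/vertical_stripP; split=> // k; rewrite nu_nth.
exists nu.
  split=> //; rewrite (vertical_strip_size vs) -gq; congr (_ + _).
  apply: eq_bigr => k _; have := ltn_ord k; rewrite -(partition_nth_gt0 _ p_rho) nu_nth.
  by case: (low q k); lia.
have [p ltp ep] := partition_index rho_j; have [p1 ltp1 ep1] := partition_index rho_j1.
(* The gap appears where length [j.+1] meets length [j]: the first row of length at most [j] has
   length [j], and the row before it has length [j.+1]. *)
have ex : exists k, nth 0 rho k <= j by exists p; rewrite ep.
case: (ex_minnP ex) => k le_k min_k.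
have lt1 : p1 < k by rewrite ltnNge; apply/negP => /(partition_nth_leq p_rho); lia.
have ek : nth 0 rho k = j.
  by apply/eqP; rewrite eqn_leq le_k -[X in X <= _]ep partition_nth_leq // min_k // ep.
case: k lt1 {le_k} min_k ek => // k lt1 min_k ek.
have ek1 : nth 0 rho k = j.+1.
  apply/eqP; rewrite eqn_leq -[X in _ <= X]ep1 partition_nth_leq //.
  by rewrite ltnNge; apply/negP => /min_k; rewrite ltnn.
exists k; rewrite !nu_nth /low ek ek1 !eqxx /= andbF orbF.
by rewrite (gtn_eqF (ltnSn j)) subn0 subn1 prednK.
Qed.

Theorem theorem4p8 (alpha : seq nat) (m : nat) :
  is_composition alpha -> 1 <= m < sumn alpha ->
  (sum_of_fat_staircases (fat_staircase alpha) (nseq m 1)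
   <->
   ~ (exists j : nat,
        [/\ 1 <= j <= size alpha - 1,
            cpart alpha j <= m
          & m <= sumn alpha - cpart alpha j.+1])).
Proof.
move=> c_alpha /andP[m_gt0 lt_m]; set rho := fat_staircase alpha.
have p_rho : is_partition rho := partition_fat_staircase alpha.
have size_rho : size rho = sumn alpha := size_fat_staircase alpha.
have le_m : m <= sumn rho.
  apply: leq_trans (size_leq_sumn _); first by rewrite size_rho ltnW.
  by case/andP: p_rho.
have sum_col : sumn (nseq m 1) = m by rewrite sumn_nseq mul1n.
have expansion : is_schur_expansion rho (nseq m 1) (column_coefficient rho m).
  by apply: schur_expansion_column; rewrite ?m_gt0 // size_rho ltnW.
have count_rho v : 0 < v <= size alpha -> count_mem v rho = cpart alpha v.
  by move=> v_in; rewrite count_mem_fat_staircase v_in.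
split=> [[c exp_c c0] [j [j_in le_j ge_j]]|no_j].
  (* Such a [j] yields a [nu] that is no fat staircase but has coefficient 1; uniqueness of the
     expansion transfers this to the given [c]. *)
  have [] := @vertical_strip_with_gap rho j m p_rho.
  - by case/andP: j_in.
  - by rewrite mem_fat_staircase //; lia.
  - by rewrite mem_fat_staircase //; lia.
  - by rewrite !count_rho ?size_rho ?le_j //; lia.
  move=> nu [p_nu vs size_nu] [i gap].
  have : c nu = 0%R.
    apply: c0 => // -[beta c_beta e]; have := fat_staircase_gap i c_beta.
    by rewrite -e leqNgt gap.
  rewrite (schur_expansion_unique exp_c expansion) /column_coefficient vs.
  by rewrite /is_partition_of p_nu size_nu addnK eqxx.
exists (column_coefficient rho m) => // nu p_nu not_fat; rewrite /column_coefficient.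
case: andP => // -[/andP[_ /eqP size_nu] vs]; case: not_fat.
(* Conversely, a gap of two in a [nu] with nonzero coefficient produces an excluded [j], namely the
   length of the lower row in [rho]. *)
apply: is_fat_staircaseP => // i; rewrite leqNgt; apply/negP => gap; apply: no_j.
have := vertical_strip_gap p_rho p_nu vs (fat_staircase_gap i c_alpha) gap.
set j := nth 0 rho i.+1 => -[j_gt0 rho_i le_j ge_j].
(* [j.+1] is a part of [rho], hence at most [size alpha]; this bounds [j] by [size alpha - 1]. *)
have : j.+1 \in rho by rewrite -rho_i mem_nth // -partition_nth_gt0 // rho_i.
rewrite mem_fat_staircase // => /andP[_ lt_j].
exists j; rewrite -!count_rho ?lt_j ?j_gt0 ?(ltnW lt_j) // -size_rho.
by split; lia.
Qed.
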